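(* Let $(X,\|\cdot\|)$ be a Banach space, $C\subseteq X$ a closed convex set, and $T:C\to C$ a nonexpansive map. Let $(\alpha_n)_{n\ge1}$ be a sequence in $[0,1]$, $(\gamma_n)_{n\ge0}$ a sequence in $[0,\infty)$, $(e_n)_{n\ge1}$ a sequence in $X$, and $x_0\in C$. Let $(x_n,z_n)_{n\in\mathbb{N}}$ be sequences such that, for all $n\in\mathbb{N}$, $$z_n\in C,\quad \|z_n-x_n\|\le d(x_n,C)+\gamma_n,\quad\text{and}\quad x_{n+1}=(1-\alpha_{n+1})x_n+\alpha_{n+1}(Tz_n+e_{n+1}).$$ Suppose that $\|e_n\|\to0$, $\sum_{k\ge1}(\alpha_k\|e_k\|+\gamma_k)<\infty$, $\sum_{k\ge1}\alpha_k(1-\alpha_k)=\infty$, and that for some $\kappa\ge0$ one has $\|x_0-Tz_n\|\le\kappa$ for all $n\in\mathbb{N}$. Then $\|x_n-z_n\|\to0$ and $\|z_n-Tz_n\|\to0$ as $n\to\infty$.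
   Context: $\mathbb{N}=\{0,1,2,\dots\}$. $T$ nonexpansive means $\|Tx-Ty\|\le\|x-y\|$ for all $x,y$ in its domain. $d(x,C)=\inf_{z\in C}\|x-z\|$. The iterates $x_n$ are not required to lie in $C$ for $n\geq 1$. *)

(* Defs.v *)
From mathcomp Require Export all_boot all_order all_algebra.
From mathcomp Require Export all_classical all_reals all_analysis.
Export Order.TTheory GRing.Theory Num.Theory numFieldNormedType.Exports.

Set Implicit Arguments.
Unset Strict Implicit.
Unset Printing Implicit Defensive.

Local Open Scope classical_set_scope.
Local Open Scope ring_scope.

(* The infimum is taken in R, so it is meaningful only for C !=set0
   (inf set0 = 0). *)
Definition dist_set (R : realType) (X : normedModType R) (x : X) (C : set X) : R :=
  inf [set `|x - z| | z in C].

(* Main.v *)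
Require Import Defs.
From mathcomp Require Import ring lra zify.

Set Implicit Arguments.
Unset Strict Implicit.
Unset Printing Implicit Defensive.

Local Open Scope classical_set_scope.
Local Open Scope ring_scope.

(** Write a_n for alpha_(n+1), y_n for T z_n and eta_n for |x_n - z_n|.

    Convexity of C gives d(x_(n+1), C) <= (1 - a_n) d(x_n, C) + a_n |e_(n+1)|.
    As a_n |e_(n+1)| is summable, so is a_n d(x_n, C); as moreover e_n --> 0
    and the sum of a_n diverges, d(x_n, C) --> 0 ([relaxed_sum_bound],
    [relaxed_cvg0]). Hence eta_n --> 0, which is the first conclusion, and
    the sum of a_n (eta_n + |e_(n+1)|) is finite.

    For the residual |x_n - y_n|, both |x_m - x_n| and |x_m - y_n| (m <= n) are
    estimated recursively: x_n is a convex combination of x_(n-1) and y_(n-1)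
    up to the error, and so is x_m with respect to x_(m-1) and y_(m-1), while
    |y_m - y_n| <= |x_m - x_n| + eta_m + eta_n by nonexpansiveness. When the
    errors vanish, unfolding this recursion is a race towards 0 between a fox
    at m and a hare at n, who move in turn. On its turn, an animal runs down
    from its position and stops below k + 1, at k, with probability a_k,
    independently for all k. The turn is the hare's for |x_m - x_n| and the
    fox's for |x_m - y_n|. The fox is caught when the hare reaches it, where
    |x_m - x_m| = 0, and escapes when it runs down to 0. Apart from an offset,
    the number of stops of the hare minus that of the fox above a descending
    level is a lazy random walk which moves by +1 and by -1 with probability
    p_k = a_k (1 - a_k) each, so the residual is at most a constant times the
    probability u_n(1) that this walk, started at 1, has not been absorbed at 0
    ([km_pursuit_bound], [km_residual_bound]). The errors add at most twice
    their weighted sum, plus eta_n.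

    The survival probability u_n(s) solves a discrete heat equation
    u_(n+1)(s) = u_n(s) - p_n w_n(s), where the curvature
    w_n(s) = 2 u_n(s) - u_n(s+1) - u_n(s-1) stays nonnegative. Thus u_n(s)
    decreases to some L(s), and the sum of p_n w_n(s) is finite. As the sum of
    p_n diverges, the limit of w_n(s) vanishes, so that L is an affine function
    of s; being bounded with L(0) = 0, it is zero ([absorbed_walk_cvg0]).

    The error term in the bound does not tend to 0, but it is a sum over the
    steps since the start: restarting the iteration at a large index makes it
    arbitrarily small ([km_residual_cvg0]). *)

(** * Series with nonnegative terms *)

Lemma sum_shift (V : nmodType) (f : nat -> V) (N n : nat) :
  \sum_(0 <= k < n) f (N + k)%N = \sum_(N <= k < N + n) f k.
Proof.
by rewrite -{2}(add0n N) big_addn addKn; apply: eq_bigr => k _; rewrite addnC.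
Qed.

Lemma unbounded_sum_shift (R : realType) (f : R ^nat) (N : nat) :
    (forall M, exists n, M < \sum_(0 <= k < n) f k) ->
    (forall k, 0 <= f k) ->
  forall M, exists n, M < \sum_(0 <= k < n) f (N + k)%N.
Proof.
move=> fsum f0 M; have [n Hn] := fsum (M + \sum_(0 <= k < N) f k).
exists n; rewrite -(ltrD2r (\sum_(0 <= k < N) f k)); apply: lt_le_trans Hn _.
rewrite sum_shift addrC -big_cat_nat ?leq_addr//.
rewrite (big_cat_nat (leq0n n) (leq_addl N n)).
by rewrite lerDl sumr_ge0.
Qed.

Lemma bounded_sum_tail (R : realType) (f : R ^nat) (B eps : R) :
    (forall k, 0 <= f k) -> (forall n, \sum_(0 <= k < n) f k <= B) -> 0 < eps ->
  exists N, forall n, \sum_(0 <= k < n) f (N + k)%N <= eps.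
Proof.
move=> f0 fB e0.
have ndf : nondecreasing_seq (series f).
  by apply/nondecreasing_seqP => n; rewrite /series /= big_nat_recr//= lerDl.
have cf : cvgn (series f).
  by apply: nondecreasing_is_cvgn => //; exists B => _ [n _ <-]; exact: fB.
have [N _ HN] : \forall n \near \oo, limn (series f) - eps <= series f n.
  by apply: (cvgr_ge _ cf); rewrite gtrBl.
exists N => n.
have := HN N (leqnn N); rewrite lerBlDr.
move=> /(le_trans (nondecreasing_cvgn_le ndf cf (N + n)%N)).
rewrite /series /= (big_cat_nat (leq0n N) (leq_addr n N)) /=.
by rewrite lerD2l sum_shift.
Qed.

Lemma bounded_sum_cvg0 (R : realType) (f : R ^nat) (B : R) :
    (forall k, 0 <= f k) -> (forall n, \sum_(0 <= k < n) f k <= B) ->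
  f n @[n --> \oo] --> (0 : R).
Proof.
move=> f0 fB; apply/cvgrPdist_le => /= h h0.
have [N HN] := bounded_sum_tail f0 fB h0.
exists N => // n /= Nn; rewrite sub0r normrN ger0_norm// -(subnKC Nn).
apply: le_trans (HN (n - N).+1); rewrite big_nat_recr //= lerDr.
exact: sumr_ge0.
Qed.

Lemma ltey_sum_bounded (R : realType) (f : R ^nat) :
    (forall k, (1 <= k)%N -> 0 <= f k) ->
    (\sum_(1 <= k <oo) (f k)%:E < +oo)%E ->
  exists B, forall n, \sum_(0 <= k < n) f k.+1 <= B.
Proof.
move=> f0 fy; set S := (X in (X < _)%E) in fy.
have f0E k : (1 <= k)%N -> true -> (0 <= (f k)%:E)%E.
  by move=> k1 _; rewrite lee_fin f0.
have S0 : (0 <= S)%E by apply: nneseries_ge0.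
exists (fine S) => n.
rewrite -lee_fin fineK ?ge0_fin_numE//.
apply: le_trans (nneseries_lim_ge n.+1 f0E).
by rewrite big_add1 /= sumEFin.
Qed.

Lemma eqy_sum_unbounded (R : realType) (f : R ^nat) :
    (forall k, (1 <= k)%N -> 0 <= f k) ->
    (\sum_(1 <= k <oo) (f k)%:E = +oo)%E ->
  forall M, exists n, M < \sum_(0 <= k < n) f k.+1.
Proof.
move=> f0 fy M; apply: contrapT => /forallNP fM.
suff : (\sum_(1 <= k <oo) (f k)%:E <= M%:E)%E by rewrite fy leye_eq.
apply: lime_le; first by apply: is_cvg_nneseries => k ? _; rewrite lee_fin f0.
apply: nearW => -[|n]; last first.
  by rewrite big_add1 /= sumEFin lee_fin leNgt; apply/negP; exact: fM.
rewrite big_geq// lee_fin leNgt; apply/negP.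
by have := fM 0%N; rewrite big_nil.
Qed.

(** The terms of index at least N contribute at least c times their weight. *)
Lemma sum_weight_lower (R : realFieldType) (p w : R ^nat) (c : R) (N n : nat) :
    (forall k, 0 <= p k) -> (forall k, 0 <= w k) -> 0 <= c ->
    (forall k, (N <= k)%N -> c <= w k) ->
  c * (\sum_(0 <= k < n) p k - \sum_(0 <= k < N) p k)
    <= \sum_(0 <= k < n) p k * w k.
Proof.
move=> p0 w0 c0 cw.
have Sge0 (f : R ^nat) i j : (forall k, 0 <= f k) -> 0 <= \sum_(i <= k < j) f k.
  by move=> f0; apply: sumr_ge0 => k _.
have pw0 k : 0 <= p k * w k by rewrite mulr_ge0.
have [nN|Nn] := leqP n N.
  rewrite (big_cat_nat (leq0n n) nN) /= opprD addrA subrr sub0r mulrN.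
  apply: (@le_trans _ _ 0); last exact: Sge0.
  by rewrite oppr_le0 mulr_ge0// Sge0.
rewrite [X in X - _](big_cat_nat (leq0n N) (ltnW Nn)) /= addrAC subrr add0r.
rewrite [leRHS](big_cat_nat (leq0n N) (ltnW Nn)) /=.
rewrite -[leLHS]add0r lerD ?Sge0// mulr_sumr ler_sum_nat// => k /andP[Nk _].
by rewrite mulrC ler_wpM2l// cw.
Qed.

(** A quantity w whose sum against a divergent weight p stays bounded cannot
    stay above a positive constant. *)
Lemma sum_weight_unbounded (R : realFieldType) (p w : R ^nat) (B c : R)
    (N : nat) :
    (forall k, 0 <= p k) -> (forall k, 0 <= w k) ->
    (forall M, exists n, M < \sum_(0 <= k < n) p k) ->
    (forall n, \sum_(0 <= k < n) p k * w k <= B) ->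
    (forall k, (N <= k)%N -> c <= w k) ->
  c <= 0.
Proof.
move=> p0 w0 psum pwB cw; rewrite leNgt; apply/negP => c0.
have [n] := psum (B / c + \sum_(0 <= k < N) p k).
rewrite -ltrBrDr ltr_pdivrMr// mulrC ltNge => /negP; apply.
exact: le_trans (sum_weight_lower _ p0 w0 (ltW c0) cw) (pwB n).
Qed.

(** * Relaxed recursions d_(n+1) <= (1 - a_n) d_n + a_n eps_n *)

Lemma relaxed_sum_bound (R : realType) (a d eps : R ^nat) :
    (forall n, 0 <= d n) ->
    (forall n, d n.+1 <= (1 - a n) * d n + a n * eps n) ->
  forall n, \sum_(0 <= k < n) a k * d k
     <= d 0 + \sum_(0 <= k < n) a k * eps k.
Proof.
move=> d0 drec n.
suff : \sum_(0 <= k < n) a k * d k + d n <=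
    d 0%N + \sum_(0 <= k < n) a k * eps k.
  by apply: le_trans; rewrite lerDl.
elim: n => [|n IH]; first by rewrite !big_nil add0r addr0.
rewrite !big_nat_recr //=; have := drec n; lra.
Qed.

Lemma relaxed_cvg0 (R : realType) (a d eps : R ^nat) (B : R) :
    (forall n, 0 <= a n <= 1) -> (forall n, 0 <= d n) ->
    (forall n, d n.+1 <= (1 - a n) * d n + a n * eps n) ->
    (forall M, exists n, M < \sum_(0 <= k < n) a k) ->
    (forall n, \sum_(0 <= k < n) a k * eps k <= B) ->
    eps n @[n --> \oo] --> (0 : R) ->
  d n @[n --> \oo] --> (0 : R).
Proof.
move=> a01 d0 drec asum aeps eps0; apply/cvgrPdist_le => /= h h0.
have [N _ HN] := cvgr_le _ eps0 _ h0.
(* Once eps is below h, the recursion preserves d_n <= h; and d_n > h for ever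
   would contradict the boundedness of the sum of the a_n d_n. *)
suff [n Nn dn] : exists2 n, (N <= n)%N & d n <= h.
  exists n => // k /= /subnK <-; rewrite sub0r normrN ger0_norm//.
  elim: (k - n)%N => // j IH; rewrite addSn; apply: le_trans (drec _) _.
  have /andP[? ?] := a01 (j + n)%N.
  have := HN (j + n)%N (leq_trans Nn (leq_addl _ _)); rewrite /=; nra.
apply: contrapT => /forall2NP dh.
suff : h <= 0 by rewrite leNgt h0.
apply: (sum_weight_unbounded (N := N) (p := a) (w := d) (B := d 0%N + B)) => //.
- by move=> k; case/andP: (a01 k).
- by move=> n; apply: le_trans (relaxed_sum_bound d0 drec n) _; rewrite lerD2l.
- by move=> k Nk; have [//|/negP] := dh k; rewrite -ltNge => /ltW.
Qed.

(** * Distance to a convex set *)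

Lemma dist_set_ge0 (R : realType) (X : normedModType R) (x : X) (C : set X) :
  0 <= dist_set x C.
Proof.
rewrite /dist_set; have [->|C0] := eqVneq C set0.
  by rewrite image_set0 inf0.
apply: lb_le_inf; last by move=> _ [z _ <-].
by apply: image_nonempty; apply/set0P.
Qed.

Lemma dist_set_le (R : realType) (X : normedModType R) (x : X) (C : set X) z :
  C z -> dist_set x C <= `|x - z|.
Proof. by move=> Cz; apply: ge_inf; [exists 0 => _ [? _ <-]|exists z]. Qed.

Lemma dist_set_conv (R : realType) (X : normedModType R) (C : set X)
    (x c e : X) (t : R) : convex_set C -> C c -> 0 <= t <= 1 ->
  dist_set ((1 - t) *: x + t *: (c + e)) C <= (1 - t) * dist_set x C + t * `|e|.
Proof.
move=> convC Cc /andP[t0 t1]; apply/ler_addgt0Pr => eps eps0.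
have [|_ [z Cz <-] ltz] := @inf_adherent _ [set `|x - z| | z in C] eps eps0.
  by split; [exists `|x - c|, c|exists 0 => _ [? _ <-]].
have Cm : C ((1 - t) *: z + t *: c).
  have := convC c z (Itv01 t0 t1).
  by rewrite !inE addrC => /(_ Cc Cz).
apply: le_trans (dist_set_le _ Cm) _.
have -> : (1 - t) *: x + t *: (c + e) - ((1 - t) *: z + t *: c)
   = (1 - t) *: (x - z) + t *: e.
  by rewrite opprD addrACA -!scalerBr addrAC subrr add0r.
apply: le_trans (ler_normD _ _) _; rewrite !normrZ !ger0_norm ?subr_ge0//.
rewrite -/(dist_set x C) in ltz; have := normr_ge0 e; nra.
Qed.

(** * A lazy symmetric random walk absorbed at 0 *)

(** The probability that a walk on the natural numbers, started at s and
    moving by +1 and by -1 with probability [p k] each at the step of index k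
    (for k = n-1, ..., 0), has not reached the absorbing state 0 in n steps. *)
Fixpoint absorbed_walk (R : realType) (p : R ^nat) (n s : nat) : R :=
  match n with
  | 0 => (0 < s)%N%:R
  | n'.+1 =>
    match s with
    | 0 => 0
    | s'.+1 => (1 - 2 * p n') * absorbed_walk p n' s'.+1
               + p n' * (absorbed_walk p n' s' + absorbed_walk p n' s'.+2)
    end
  end.

(** The opposite of the second difference of the survival probability around
    [s.+1]; the shift of the index avoids a predecessor. *)
Definition walk_curv (R : realType) (p : R ^nat) (n s : nat) : R :=
  2 * absorbed_walk p n s.+1 - absorbed_walk p n s - absorbed_walk p n s.+2.

Section Walk.
Context (R : realType) (p : R ^nat) (p01 : forall n, 0 <= p n <= 2^-1).
Local Notation u := (absorbed_walk p).
Local Notation w := (walk_curv p).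

Lemma absorbed_walk0 n : u n 0 = 0.
Proof. by case: n. Qed.

Lemma absorbed_walk_step n s : u n.+1 s.+1 = u n s.+1 - p n * w n s.
Proof. by rewrite /walk_curv /=; ring. Qed.

Lemma absorbed_walk_itv n s : 0 <= u n s <= 1.
Proof.
elim: n s => [|n IH] [|s] /=; rewrite ?ler01 ?lexx //.
have /andP[p0 p1] := p01 n; have /andP[a0 a1] := IH s.+1.
have /andP[b0 b1] := IH s; have /andP[c0 c1] := IH s.+2.
apply/andP; split; nra.
Qed.

(** The initial datum 0, 1, 1, ... is concave, and the curvature obeys the same
    averaging recursion as the walk, with value 0 at the absorbing state. *)
Lemma walk_curv_ge0 n s : 0 <= w n s.
Proof.
elim: n s => [|n IH] s.
  by case: s => [|s]; rewrite /walk_curv /=; lra.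
have /andP[p0 p1] := p01 n.
have w0 := IH s; have w1 := IH s.+1.
case: s w0 w1 => [|s] w0 w1.
  have -> : w n.+1 0 = (1 - 2 * p n) * w n 0 + p n * w n 1.
    by rewrite /walk_curv !absorbed_walk_step /walk_curv !absorbed_walk0; ring.
  nra.
have w2 := IH s.
have -> : w n.+1 s.+1 = (1 - 2 * p n) * w n s.+1 + p n * (w n s + w n s.+2).
  by rewrite /walk_curv !absorbed_walk_step /walk_curv; ring.
nra.
Qed.

Lemma absorbed_walk_nonincreasing s : nonincreasing_seq (u ^~ s).
Proof.
apply/nonincreasing_seqP => n.
case: s => [|s]; first by rewrite !absorbed_walk0.
rewrite absorbed_walk_step gerBl mulr_ge0 ?walk_curv_ge0//.
by case/andP: (p01 n).
Qed.

Lemma sum_walk_curv n s : \sum_(0 <= k < n) p k * w k s = u 0 s.+1 - u n s.+1.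
Proof.
elim: n => [|n IH]; first by rewrite big_nil subrr.
by rewrite big_nat_recr // IH absorbed_walk_step opprB [_ * _ - _]addrC addrA.
Qed.

Context (p_sum : forall M, exists n, M < \sum_(0 <= k < n) p k).

Lemma absorbed_walk_cvg0 s : u n s @[n --> \oo] --> (0 : R).
Proof.
have cu t : cvgn (u ^~ t).
  apply: nonincreasing_is_cvgn; first exact: absorbed_walk_nonincreasing.
  by exists 0 => _ [n _ <-]; case/andP: (absorbed_walk_itv n t).
pose L t := limn (u ^~ t).
have Lge t n : L t <= u n t.
  by apply: nonincreasing_cvgn_ge => //; exact: absorbed_walk_nonincreasing.
have L0 : L 0%N = 0.
  rewrite /L (_ : u ^~ 0%N = cst 0) ?lim_cst//.
  by apply/funext => n; exact: absorbed_walk0.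
have Lge0 t : 0 <= L t.
  apply: limr_ge => //; apply: nearW => n.
  by case/andP: (absorbed_walk_itv n t).
have wcvg t : w n t @[n --> \oo] --> 2 * L t.+1 - L t - L t.+2.
  by apply: cvgB; [apply: cvgB; [apply: cvgMr|]|]; exact: cu.
have Lrec t : L t.+2 = 2 * L t.+1 - L t.
  apply/eqP; rewrite eq_le; apply/andP; split.
    rewrite -subr_ge0 -(cvg_lim _ (wcvg t))//.
    apply: limr_ge; first exact: cvgP (wcvg t).
    by apply: nearW => n; exact: walk_curv_ge0.
  rewrite leNgt; apply/negP; rewrite -subr_gt0 => W0.
  (* A positive limit W of the curvatures would make the bounded sums of the
     p_k w_k(t) diverge. *)
  set W := _ - _ - _ in W0.
  have [N _ HN] : \forall n \near \oo, W / 2 <= w n t.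
    by apply: (cvgr_ge _ (wcvg t)); rewrite ltr_pdivrMr// ltr_pMr// ltr1n.
  suff : W / 2 <= 0 by apply/negP; rewrite -ltNge divr_gt0.
  apply: (sum_weight_unbounded (N := N) (B := 1) (p := p) (w := w ^~ t)) => //.
  - by move=> k; case/andP: (p01 k).
  - by move=> k; exact: walk_curv_ge0.
  - move=> n; rewrite sum_walk_curv -[leRHS]subr0 lerB//.
    by case/andP: (absorbed_walk_itv n t.+1).
have Lt t : L t = t%:R * L 1%N.
  suff : L t = t%:R * L 1%N /\ L t.+1 = t.+1%:R * L 1%N by case.
  elim: t => [|t [IH1 IH2]]; first by rewrite L0 mul0r mul1r.
  by split=> //; rewrite Lrec IH1 IH2 -!natr1; ring.
have L1 : L 1%N = 0.
  apply/eqP; rewrite eq_le Lge0 andbT leNgt; apply/negP => L1.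
  have Lle1 t : L t <= 1.
    by apply: le_trans (Lge t 0%N) _; case: t => //=; rewrite ler01.
  have iL0 : 0 <= (L 1%N)^-1 by rewrite invr_ge0 ltW.
  have := archi_boundP iL0; set n := Num.bound _.
  rewrite -[ltLHS]div1r ltr_pdivrMr// -Lt => /lt_le_trans/(_ (Lle1 n)).
  by rewrite ltxx.
by have <- : L s = 0 by [rewrite Lt L1 mulr0]; exact: cu.
Qed.

End Walk.

(** * Asymptotic regularity of inexact averaged iterations *)

(** The expectation of [absorbed_walk _ m (s + h)], where h counts the successes
    of independent trials of probability [a m], ..., [a (m + l - 1)]. It is the
    probability that a fox at m escapes from a hare at m + l when it is the
    fox's turn (s = 1, the case of |x_m - y_(m+l)|) or the hare's turn (s = 0,
    the case of |x_m - x_(m+l)|). *)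
Fixpoint pursuit (R : realType) (a : R ^nat) (m l s : nat) : R :=
  match l with
  | 0 => absorbed_walk (fun k => a k * (1 - a k)) m s
  | l'.+1 => (1 - a (m + l')%N) * pursuit a m l' s
             + a (m + l')%N * pursuit a m l' s.+1
  end.

Lemma pursuit0 (R : realType) (a : R ^nat) (l s : nat) : pursuit a 0 l s.+1 = 1.
Proof. by elim: l s => [|l IH] s //=; rewrite !IH; ring. Qed.

(** Conditioning on the trial of index m, made by the fox: it leaves the hare's
    count unchanged when it fails and lowers it by one when it succeeds. *)
Lemma pursuitS (R : realType) (a : R ^nat) (m l s : nat) :
  pursuit a m.+1 l s.+1 =
    (1 - a m) * pursuit a m l.+1 s.+1 + a m * pursuit a m l.+1 s.
Proof.
elim: l s => [|l IH] s; first by rewrite /= addn0; ring.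
have E k : pursuit a m.+1 l.+1 k = (1 - a (m + l.+1)%N) * pursuit a m.+1 l k
             + a (m + l.+1)%N * pursuit a m.+1 l k.+1.
  by rewrite /= addnS.
have F k : pursuit a m l.+2 k = (1 - a (m + l.+1)%N) * pursuit a m l.+1 k
             + a (m + l.+1)%N * pursuit a m l.+1 k.+1 by [].
by rewrite E !F !IH; ring.
Qed.

Section KM.
Context (R : realType) (X : normedModType R) (a : R ^nat) (x y e : X ^nat).
Context (a01 : forall n, 0 <= a n <= 1).
Context (x_rec : forall n, x n.+1 = (1 - a n) *: x n + a n *: (y n + e n)).

Lemma km_step_dist n (q : X) :
  `|x n.+1 - q| <= (1 - a n) * `|x n - q| + a n * (`|y n - q| + `|e n|).
Proof.
have /andP[a0 a1] := a01 n.
have -> : x n.+1 - q = (1 - a n) *: (x n - q) + a n *: ((y n - q) + e n).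
  have {1}-> : q = (1 - a n) *: q + a n *: q by rewrite -scalerDl subrK scale1r.
  by rewrite x_rec opprD addrACA -!scalerBr [y n + _ - _]addrAC.
apply: (le_trans (ler_normD _ _)); rewrite !normrZ ger0_norm ?subr_ge0//.
by rewrite ger0_norm// lerD2l ler_wpM2l// ler_normD.
Qed.

Context (eta : R ^nat) (kappa : R).
Context (eta_ge0 : forall n, 0 <= eta n).
Context (y_dist : forall m n, `|y m - y n| <= `|x m - x n| + eta m + eta n).
Context (x0_y : forall n, `|x 0 - y n| <= kappa).
Let sigma n := \sum_(0 <= k < n) a k * (eta k + `|e k|).

(** Domination of the distances by the pursuit probabilities, with the errors
    accumulated along both paths. *)
Lemma km_pursuit_bound m l :
  `|x m - x (m + l)%N| <= kappa * pursuit a m l 0 + sigma m + sigma (m + l)%N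
  /\ `|x m - y (m + l)%N| <=
       kappa * pursuit a m l 1 + sigma m + sigma (m + l)%N + eta (m + l)%N.
Proof.
have sigmaS n : sigma n.+1 = sigma n + a n * (eta n + `|e n|).
  by rewrite /sigma big_nat_recr.
have sigma_ge0 n : 0 <= sigma n.
  apply: sumr_ge0 => i _; case/andP: (a01 i) => ? _.
  by rewrite mulr_ge0// addr_ge0.
(* For fixed k, the bounds on |x_k - y_n| imply those on |x_k - x_n|, by
   induction on n >= k. *)
have B_D k : (forall l, `|x k - y (k + l)%N| <=
    kappa * pursuit a k l 1 + sigma k + sigma (k + l)%N + eta (k + l)%N) ->
  forall l, `|x k - x (k + l)%N| <=
    kappa * pursuit a k l 0 + sigma k + sigma (k + l)%N.
  move=> B; elim=> [|j IH].
    rewrite addn0 subrr normr0 /= absorbed_walk0 mulr0 add0r.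
    by rewrite addr_ge0.
  rewrite addnS distrC; set n := (k + j)%N.
  apply: le_trans (km_step_dist _ _) _.
  have /andP[a0 a1] := a01 n; have Bj := B j.
  rewrite distrC in IH; rewrite distrC in Bj.
  rewrite sigmaS /= -/n -/n in IH Bj *; nra.
elim: m l => [|m IH] l.
  have B j : `|x 0%N - y (0 + j)%N| <= kappa * pursuit a 0 j 1 + sigma 0%N
      + sigma (0 + j)%N + eta (0 + j)%N.
    rewrite pursuit0 mulr1; apply: le_trans (x0_y _) _.
    by rewrite -!addrA lerDl !addr_ge0.
  by split; [exact: B_D|exact: B].
(* One step of x_(m+1) reduces this to the two bounds for x_m. *)
have B j : `|x m.+1 - y (m.+1 + j)%N| <= kappa * pursuit a m.+1 j 1
    + sigma m.+1 + sigma (m.+1 + j)%N + eta (m.+1 + j)%N.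
  have [] := IH j.+1; rewrite -addSnnS; set n := (m.+1 + j)%N => D B.
  apply: le_trans (km_step_dist _ _) _.
  have /andP[a0 a1] := a01 m; have yD := y_dist m n.
  rewrite pursuitS sigmaS; nra.
by split; [exact: B_D|exact: B].
Qed.

Lemma km_residual_bound n :
  `|x n - y n| <= kappa * absorbed_walk (fun k => a k * (1 - a k)) n 1
                  + sigma n + sigma n + eta n.
Proof. by have [_] := km_pursuit_bound n 0; rewrite addn0. Qed.

End KM.

(** The sequence y plays the role of T z_n, and eta that of |x_n - z_n|: only
    the approximate nonexpansiveness of x_n |-> y_n matters. *)
Lemma km_residual_cvg0 (R : realType) (X : normedModType R)
    (a eta : R ^nat) (x y e : X ^nat) (B kappa : R) :
    (forall n, 0 <= a n <= 1) ->
    (forall n, x n.+1 = (1 - a n) *: x n + a n *: (y n + e n)) ->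
    (forall n, 0 <= eta n) ->
    (forall m n, `|y m - y n| <= `|x m - x n| + eta m + eta n) ->
    (forall m n, `|x m - y n| <= kappa) ->
    (forall n, \sum_(0 <= k < n) a k * (eta k + `|e k|) <= B) ->
    (forall M, exists n, M < \sum_(0 <= k < n) a k * (1 - a k)) ->
    eta n @[n --> \oo] --> (0 : R) ->
  `|x n - y n| @[n --> \oo] --> (0 : R).
Proof.
move=> a01 x_rec eta0 y_dist xy sumB sumoo etacvg.
have p01 n : 0 <= a n * (1 - a n) <= 2^-1.
  by have /andP[? ?] := a01 n; apply/andP; split; nra.
apply/cvgrPdist_le => /= h h0.
have h4 : 0 < h / 4 by rewrite divr_gt0.
have err0 k : 0 <= a k * (eta k + `|e k|).
  by case/andP: (a01 k) => ? _; rewrite mulr_ge0// addr_ge0.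
(* The iteration is restarted at an index N beyond which the accumulated errors
   are at most h / 4. *)
have [N tailN] := bounded_sum_tail err0 sumB h4.
have sumNoo := unbounded_sum_shift N sumoo (fun k => proj1 (andP (p01 k))).
have walk0 : kappa * absorbed_walk
    (fun k => a (N + k)%N * (1 - a (N + k)%N)) n 1 @[n --> \oo] --> (0 : R).
  rewrite -[X in _ --> X](mulr0 kappa); apply: cvgMr.
  by apply: absorbed_walk_cvg0 => // n; exact: p01.
have [N1 _ HN1] := cvgr_le _ walk0 _ h4.
have [N2 _ HN2] := cvgr_le _ etacvg _ h4.
exists (N + (N1 + N2))%N => // m /= Hm.
rewrite sub0r normrN normr_id.
have Nm : (N <= m)%N by lia.
have -> : m = (N + (m - N))%N by rewrite subnKC.
set n := (m - N)%N.
apply: le_trans (km_residual_bound (a := fun k => a (N + k)%N)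
  (x := fun k => x (N + k)%N) (y := fun k => y (N + k)%N)
  (e := fun k => e (N + k)%N) (eta := fun k => eta (N + k)%N)
  (kappa := kappa) _ _ _ _ _ n) _ => //.
  by move=> k; rewrite addnS.
have n1 : (N1 <= n)%N by rewrite /n; lia.
have n2 : (N2 <= N + n)%N by rewrite /n; lia.
have := HN1 n n1; have := HN2 (N + n)%N n2; have /= := tailN n; lra.
Qed.

Theorem theorem4p1 (R : realType) (X : completeNormedModType R)
    (C : set X) (C_closed : closed C) (C_convex : convex_set C)
    (T : {fun C >-> C}) (T_nonexpansive : 1.-lipschitz_C T)
    (alpha gamma : R ^nat) (e : X ^nat)
    (alpha01 : forall n, (1 <= n)%N -> 0 <= alpha n <= 1)
    (gamma_ge0 : forall n, 0 <= gamma n)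
    (x z : X ^nat) (x0C : C (x 0%N))
    (zC : forall n, C (z n))
    (z_proj : forall n, `|z n - x n| <= dist_set (x n) C + gamma n)
    (x_rec : forall n, x n.+1 =
      (1 - alpha n.+1) *: x n + alpha n.+1 *: (T (z n) + e n.+1))
    (e_cvg0 : `|e n| @[n --> \oo] --> (0 : R))
    (sum_lty : (\sum_(1 <= k <oo) (alpha k * `|e k| + gamma k)%:E < +oo)%E)
    (sum_eqy : (\sum_(1 <= k <oo) (alpha k * (1 - alpha k))%:E = +oo)%E)
    (T_bounded : exists2 kappa : R,
      0 <= kappa & forall n, `|x 0%N - T (z n)| <= kappa) :
  `|x n - z n| @[n --> \oo] --> (0 : R) /\
  `|z n - T (z n)| @[n --> \oo] --> (0 : R).
Proof.
have [kappa kappa0 x0T] := T_bounded.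
pose a n := alpha n.+1.
pose delta n := dist_set (x n) C.
pose eta n := `|x n - z n|.
have a01 n : 0 <= a n <= 1 by exact: alpha01.
have a_ge0 n : 0 <= a n by case/andP: (a01 n).
have ae_ge0 k : 0 <= a k * `|e k.+1| by rewrite mulr_ge0.
have TC n : C (T (z n)) by apply: funS.
have [B sumB] : exists B, forall n,
    \sum_(0 <= k < n) (a k * `|e k.+1| + gamma k.+1) <= B.
  apply: (ltey_sum_bounded (f := fun k => alpha k * `|e k| + gamma k)) => //.
  move=> k k1.
  by rewrite addr_ge0// mulr_ge0//; case/andP: (alpha01 k k1).
have sum_ae n : \sum_(0 <= k < n) a k * `|e k.+1| <= B.
  by apply: le_trans (sumB n); apply: ler_sum => k _; rewrite lerDl.
have sum_gamma n : \sum_(0 <= k < n) gamma k.+1 <= B.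
  by apply: le_trans (sumB n); apply: ler_sum => k _; rewrite lerDr.
have sum_aa : forall M, exists n, M < \sum_(0 <= k < n) a k * (1 - a k).
  apply: (eqy_sum_unbounded (f := fun k => alpha k * (1 - alpha k))) => // k k1.
  by have /andP[? ?] := alpha01 k k1; rewrite mulr_ge0// subr_ge0.
have sum_a M : exists n, M < \sum_(0 <= k < n) a k.
  have [n Mn] := sum_aa M; exists n; apply: lt_le_trans Mn _.
  by apply: ler_sum => k _; rewrite ler_piMr// gerBl.
have delta_ge0 n : 0 <= delta n by exact: dist_set_ge0.
have delta_rec n : delta n.+1 <= (1 - a n) * delta n + a n * `|e n.+1|.
  by rewrite /delta x_rec; exact: (dist_set_conv _ _ C_convex (TC n) (a01 n)).
have delta0 : delta n @[n --> \oo] --> (0 : R).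
  apply: (relaxed_cvg0 a01 delta_ge0 delta_rec sum_a sum_ae).
  by rewrite (cvg_shiftS (fun n => `|e n|)).
have gamma0 : gamma n @[n --> \oo] --> (0 : R).
  by rewrite -cvg_shiftS; apply: (bounded_sum_cvg0 (B := B)).
have eta_ge0 n : 0 <= eta n by exact: normr_ge0.
have eta_le n : eta n <= delta n + gamma n by rewrite /eta distrC.
have eta0 : eta n @[n --> \oo] --> (0 : R).
  apply: (@squeeze_cvgr _ _ _ _ (cst 0) (delta \+ gamma)).
  - by apply: nearW => n; rewrite normr_ge0 eta_le.
  - exact: cvg_cst.
  - by rewrite -[X in _ --> X](addr0 0); exact: cvgD.
split=> //.
have T_dist m n : `|T (z m) - T (z n)| <= `|z m - z n|.
  by have := T_nonexpansive (z m, z n) (conj (zC m) (zC n)); rewrite /= mul1r.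
(* The restarted iterations need a bound on |x_m - y_n| uniform in m. *)
have x_dist n : `|x n - x 0%N| <= kappa + \sum_(0 <= k < n) a k * `|e k.+1|.
  elim: n => [|n IH]; first by rewrite subrr normr0 big_nil addr0.
  apply: le_trans (km_step_dist (a := a) (y := T \o z)
    (e := fun k => e k.+1) a01 x_rec _ _) _.
  rewrite big_nat_recr //=; have := x0T n; rewrite distrC.
  have /andP[? ?] := a01 n.
  have : 0 <= \sum_(0 <= k < n) a k * `|e k.+1| by exact: sumr_ge0.
  nra.
have resid0 : `|x n - T (z n)| @[n --> \oo] --> (0 : R).
  apply: (@km_residual_cvg0 R X a eta x (T \o z) (fun k => e k.+1)
    (delta 0%N + B + (gamma 0%N + B) + B) (kappa + B + kappa)) => //=.
  - move=> m n; apply: le_trans (T_dist m n) _.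
    have -> : z m - z n = (x m - x n) - (x m - z m) + (x n - z n).
      by rewrite opprB [x m - x n + _]addrC !subrKA.
    by apply: le_trans (ler_normD _ _) _; rewrite lerD2r; exact: ler_normB.
  - move=> m n; rewrite -(subrKA (x 0%N)); apply: le_trans (ler_normD _ _) _.
    by rewrite lerD// (le_trans (x_dist m))// lerD2l.
  - move=> n; have := relaxed_sum_bound delta_ge0 delta_rec n.
    rewrite -/a => sum_ad.
    have sum_ag : \sum_(0 <= k < n) a k * gamma k <= gamma 0%N + B.
      apply: (@le_trans _ _ (\sum_(0 <= k < n.+1) gamma k)).
        rewrite big_nat_recr //= -[leLHS]addr0 lerD// ler_sum// => k _.
        by rewrite ler_piMl//; case/andP: (a01 k).
      by rewrite big_nat_recl //= lerD2l.
    have -> : \sum_(0 <= k < n) a k * (eta k + `|e k.+1|) =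
        \sum_(0 <= k < n) a k * eta k + \sum_(0 <= k < n) a k * `|e k.+1|.
      by rewrite -big_split; apply: eq_bigr => k _; rewrite mulrDr.
    have : \sum_(0 <= k < n) a k * eta k <=
        \sum_(0 <= k < n) a k * delta k + \sum_(0 <= k < n) a k * gamma k.
      rewrite -big_split /=; apply: ler_sum => k _.
      by rewrite -mulrDr ler_wpM2l.
    have := sum_ae n; lra.
apply: (@squeeze_cvgr _ _ _ _ (cst 0) (eta \+ (fun n => `|x n - T (z n)|))).
- apply: nearW => n; rewrite normr_ge0 /= /eta (distrC (x n)).
  by have := ler_normD (z n - x n) (x n - T (z n)); rewrite subrKA.
- exact: cvg_cst.
- by rewrite -[X in _ --> X](addr0 0); exact: cvgD.
Qed.
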